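(* Let $\mathcal{S}=((X,d),(f_i)_{i\in I\cup J})$ be a mixed possibly infinite iterated function system (mIIFS) and let $B\in P_{b,cl}(X)$. Then $$\overline{\{\mathcal{A}_\alpha(x)\mid \alpha\in\Sigma(I,J)\text{ and }x\in B\}}=A_B .$$
   Context: Notation: $\mathbb{N}=\{1,2,\dots\}$. For a metric space $(X,d)$, $P_b(X)$ is the set of nonempty bounded subsets of $X$ and $P_{b,cl}(X)$ the set of nonempty closed bounded subsets; $h$ is the Hausdorff-Pompeiu metric on $P_{b,cl}(X)$. $lip(f)$ is the Lipschitz constant of a Lipschitz map $f$. Words: for a set $K$, $\Lambda(K)=K^{\mathbb{N}}$ is the set of infinite words $\alpha=\alpha_1\alpha_2\dots$ with letters in $K$; $\Lambda_n(K)$ is the set of words of length $n$; $\Lambda_0(K)=\{\lambda\}$ with $\lambda$ the empty word; $\Lambda^*(K)=\bigcup_{n\ge 0}\Lambda_n(K)$. $[\alpha]_m$ is the word formed by the first $m$ letters of $\alpha$. For maps $f_i:X\to X$ ($i\in K$) and $\alpha=\alpha_1\dots\alpha_n\in\Lambda_n(K)$, $f_\alpha=f_{\alpha_1}\circ\dots\circ f_{\alpha_n}$, and $f_\lambda=Id_X$. mIIFS: a pair $\mathcal{S}=((X,d),(f_i)_{i\in I\cup J})$ where $(X,d)$ is a complete metric space, $I$ and $J$ are disjoint sets, $f_i:X\to X$ are continuous, $\bigcup_{i\in I\cup J}f_i(B)\in P_b(X)$ for every $B\in P_b(X)$, and: (a) $lip(f_i)\le 1$ for every $i\in I\cup J$;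 (b) there exists $a\in[0,1)$ such that $lip(f_i)\le a$ for every $i\in I$, and, for every $x\in X$ and every $i\in J$, the restriction of $f_i$ to $\overline{\mathcal{O}_J(x)}$ has Lipschitz constant at most $a$, where $\mathcal{O}_J(x)=\bigcup_{n\ge 0}\overline{\{f_\alpha(x)\mid\alpha\in\Lambda_n(J)\}}$. Fractal operator: $F_{\mathcal{S}}:P_{b,cl}(X)\to P_{b,cl}(X)$, $F_{\mathcal{S}}(B)=\overline{\bigcup_{i\in I\cup J}f_i(B)}$. It is known that for every mIIFS and every $B\in P_{b,cl}(X)$ the sequence of iterates $F_{\mathcal{S}}^{[n]}(B)$ converges with respect to $h$ to a fixed point of $F_{\mathcal{S}}$; this limit is denoted $A_B$. Maps $a_\alpha$: for every $\alpha\in\Lambda(I\cup J)$ and $x\in X$ the sequence $(f_{[\alpha]_n}(x))_{n}$ converges; $a_\alpha:X\to X$ is defined by $a_\alpha(x)=\lim_{n\to\infty}f_{[\alpha]_n}(x)$. Index set $\Sigma(I,J)=\Sigma_0(I,J)\cup\Sigma_1(I,J)$: $\Sigma_1(I,J)$ is the set of $\alpha\in\Lambda(I\cup J)$ having infinitely many letters in $I$. $\Sigma_0(I,J)$ is the set of finite words with letters from $I\cup J\cup\Lambda(J)$ of the form $\beta_0\gamma_1\beta_1\dots\gamma_n\beta_n$ with $n\in\mathbb{N}$, where $\gamma_k\in\Lambda(J)$ for $k\in\{1,\dots,n\}$ (each infinite word $\gamma_k$ counted as one letter); $\beta_0$ is either $\lambda$ or a finite word with letters from $I\cup J$ ending with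 a letter from $I$; $\beta_n$ is either $\lambda$ or a finite word with letters from $I\cup J$ starting with a letter from $I$; and, if $n\ge2$, for $k\in\{1,\dots,n-1\}$, $\beta_k$ is a finite word with letters from $I\cup J$ starting and ending with letters from $I$. Maps $\mathcal{A}_\alpha:X\to X$ for $\alpha\in\Sigma(I,J)$: $\mathcal{A}_\alpha=a_\alpha$ if $\alpha\in\Sigma_1(I,J)$, and $\mathcal{A}_\alpha=f_{\beta_0}\circ a_{\gamma_1}\circ f_{\beta_1}\circ a_{\gamma_2}\circ\dots\circ f_{\beta_{n-1}}\circ a_{\gamma_n}\circ f_{\beta_n}$ if $\alpha=\beta_0\gamma_1\beta_1\dots\gamma_n\beta_n\in\Sigma_0(I,J)$. *)

(* Defs.v *)
From HB Require Import structures.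
From mathcomp Require Import all_boot all_order all_algebra.
From mathcomp Require Import all_classical all_reals all_analysis.

Set Implicit Arguments.
Unset Strict Implicit.
Unset Printing Implicit Defensive.

Import Order.TTheory GRing.Theory Num.Theory.
Import numFieldNormedType.Exports.

Local Open Scope classical_set_scope.
Local Open Scope ring_scope.

(* [Complete] carries a distinguished point, which provides the default value
   of [lim].  *)
#[short(type="completeMetricType")]
HB.structure Definition CompleteMetric (R : numDomainType) :=
  {T of Complete T & Metric R T}.

Section MetricNotions.
Context {R : realType} {X : metricType R}.

Definition metric_bounded (A : set X) : Prop :=
  exists M : R, forall x y, A x -> A y -> mdist x y <= M.

Definition Pb : set (set X) := [set A | A !=set0 /\ metric_bounded A].

Definition Pbcl : set (set X) :=
  [set A | [/\ A !=set0, closed A & metric_bounded A]].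

(* Lipschitz constant of the restriction of [g] to [A], equal to [+oo] if this
   restriction is not Lipschitz.  The pairs with [x = y] contribute
   [0 / 0 = 0], so that it is [0] when [A] is a singleton. *)
Definition lip_on (A : set X) (g : X -> X) : \bar R :=
  ereal_sup [set (mdist (g p.1) (g p.2) / mdist p.1 p.2)%:E | p in A `*` A].

Definition lip (g : X -> X) : \bar R := lip_on [set: X] g.

Definition dist_to_set (x : X) (A : set X) : R := inf [set mdist x y | y in A].

(* Meaningful on [Pbcl], where the suprema and infima are those of nonempty
   bounded sets of reals. *)
Definition hausdorff_metric (A B : set X) : R :=
  Num.max (sup [set dist_to_set x B | x in A])
          (sup [set dist_to_set y A | y in B]).

End MetricNotions.

(* The letter [alpha_n], n >= 1, of an infinite word is [alpha n.-1]. *)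
Definition infword (K : Type) : Type := nat -> K.

Definition infword_prefix (K : Type) (alpha : infword K) (m : nat) : seq K :=
  mkseq alpha m.

Definition word_map (K T : Type) (f : K -> T -> T) (w : seq K) : T -> T :=
  foldr (fun k g => f k \o g) id w.

Section MixedSystems.
(* The disjoint union of the index sets is the sum type [I + J]. *)
Context {R : realType} {X : completeMetricType R} {I J : Type}.
Implicit Types (f : I + J -> X -> X) (w : seq (I + J)).

Definition Jorbit f (x : X) : set X :=
  \bigcup_n closure
    [set word_map f (map inr w) x | w in [set w : seq J | size w = n]].

Record mIIFS f : Prop := {
  mIIFS_continuous : forall k, continuous (f k) ;
  mIIFS_bounded : forall B, Pb B -> Pb (\bigcup_k (f k @` B)) ;
  mIIFS_nonexpansive : forall k, (lip (f k) <= 1%:E)%E ;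
  mIIFS_contractive : exists2 a : R, 0 <= a < 1 &
    (forall i : I, (lip (f (inl i)) <= a%:E)%E) /\
    (forall (x : X) (j : J),
       (lip_on (closure (Jorbit f x)) (f (inr j)) <= a%:E)%E)
}.

Definition fractal_operator f (B : set X) : set X :=
  closure (\bigcup_k (f k @` B)).

(* [A_B]: the limit of the iterates in [(Pbcl, hausdorff_metric)]. *)
Definition fractal_limit f (B : set X) : set X :=
  get [set A | Pbcl A /\
    hausdorff_metric (iter n (fractal_operator f) B) A @[n --> \oo]
      --> (0 : R)].

Definition a_map f (alpha : infword (I + J)) (x : X) : X :=
  lim (word_map f (infword_prefix alpha n) x @[n --> \oo]).

Definition letter_in_I (k : I + J) : bool := if k is inl _ then true else false.

Definition starts_in_I w : bool := if w is k :: _ then letter_in_I k else false.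

Definition ends_in_I w : bool := starts_in_I (rev w).

Definition Sigma1 : set (infword (I + J)) :=
  [set alpha | infinite_set [set n | letter_in_I (alpha n)]].

(* The word [beta_0 gamma_1 beta_1 ... gamma_n beta_n] is encoded by [beta_0]
   and the sequence of the pairs [(gamma_k, beta_k)], 1 <= k <= n.  As each
   [gamma_k] is a single letter from [infword J] and the [beta_k] contain no
   such letter, the word and this decomposition determine each other. *)
Record block_word := BlockWord {
  bw_head : seq (I + J) ;
  bw_blocks : seq (infword J * seq (I + J))
}.

Definition bw_size (alpha : block_word) : nat := size (bw_blocks alpha).

Definition bw_beta (alpha : block_word) (k : nat) : seq (I + J) :=
  nth [::] (bw_head alpha :: unzip2 (bw_blocks alpha)) k.

Definition Sigma0 : set block_word :=
  [set alpha | let n := bw_size alpha in let beta := bw_beta alpha in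
    [/\ (0 < n)%N,
        beta 0%N = [::] \/ ends_in_I (beta 0%N),
        beta n = [::] \/ starts_in_I (beta n) &
        forall k : nat, (0 < k < n)%N ->
          starts_in_I (beta k) /\ ends_in_I (beta k)]].

Definition Sigma : set (block_word + infword (I + J)) :=
  (inl @` Sigma0) `|` (inr @` Sigma1).

Definition block_map f (alpha : block_word) : X -> X :=
  word_map f (bw_head alpha) \o
  foldr (fun p g => a_map f (inr \o p.1) \o word_map f p.2 \o g) id
    (bw_blocks alpha).

Definition calA f (alpha : block_word + infword (I + J)) : X -> X :=
  match alpha with
  | inl alpha0 => block_map f alpha0
  | inr alpha1 => a_map f alpha1
  end.

End MixedSystems.

Arguments block_word : clear implicits.
Arguments Sigma0 : clear implicits.
Arguments Sigma1 : clear implicits.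
Arguments Sigma : clear implicits.

(* Main.v *)
Require Import Defs.
From mathcomp Require Import all_boot all_order all_algebra.
From mathcomp Require Import all_classical all_reals all_analysis.
From mathcomp Require Import ring lra zify.

(* Along letters from [J] the maps contract only inside one [J]-orbit, while a
   letter from [I] contracts everywhere.  Hence all points [f_w x], [w] a finite
   word and [x] in [B], lie at mutual distance at most some [K].  A long word
   either has many letters from [I], so that [f_w x] is close to [a_alpha x] for
   any [alpha] in [Sigma1] extending [w], or contains a long maximal block of
   letters from [J], which may be prolonged to an infinite word [gamma], so that
   [f_w x] is close to [f_u (a_gamma (f_z x))] with [u gamma z] in [Sigma0].
   Conversely every value of [A_alpha] is a limit of points [f_w x] with longer
   and longer words.  As long words may be replaced by words of any prescribed
   large length, the iterates of the fractal operator, which are the closures of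
   the sets of the [f_w x] with [w] of length [n], converge to the closure of the
   set of values. *)

Import Order.TTheory GRing.Theory Num.Theory.
Import numFieldNormedType.Exports.
Import metricType_numDomainType.

Local Open Scope classical_set_scope.
Local Open Scope ring_scope.

(** * Closures, the Hausdorff-Pompeiu distance and Lipschitz estimates *)

Section MetricFacts.
Context {R : realType} {X : metricType R}.
Implicit Types (x y z : X) (A B C : set X).

Lemma metric_triangle3 x y z t :
  mdist x t <= mdist x y + mdist y z + mdist z t.
Proof.
by rewrite (le_trans (metric_triangle _ z _))// lerD2r metric_triangle.
Qed.

Lemma closure_mdistP A x :
  closure A x <-> forall e : R, 0 < e -> exists2 y, A y & mdist x y < e.
Proof.
split=> [Ax e e0|Ax U].
  have [y [Ay]] := Ax _ (nbhsx_ballx x e e0).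
  by rewrite ballEmdist => xy; exists y.
rewrite -filter_from_mdist_nbhs => -[e e0 xeU].
by have [y Ay xy] := Ax e e0; exists y; split=> //; exact: xeU.
Qed.

Lemma metric_bounded_closure A : metric_bounded A -> metric_bounded (closure A).
Proof.
move=> [M AM]; exists M => x y /closure_mdistP Ax /closure_mdistP Ay.
apply/ler_addgt0Pr => e e0; have e20 : 0 < e / 2 by rewrite divr_gt0.
have [x' Ax' xx'] := Ax _ e20; have [y' Ay' yy'] := Ay _ e20.
have := metric_triangle3 x x' y' y; have := AM _ _ Ax' Ay'.
by rewrite (metric_sym y' y); lra.
Qed.

Lemma Pbcl_closure A : Pb A -> Pbcl (closure A).
Proof.
move=> [[x Ax] Ab]; split; last exact: metric_bounded_closure.
  by exists x; exact: subset_closure.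
exact: closed_closure.
Qed.

Lemma dist_to_set_le x y A : A y -> dist_to_set x A <= mdist x y.
Proof.
move=> Ay; apply: ge_inf; last by exists y.
by exists 0 => _ [z _ <-]; exact: mdist_ge0.
Qed.

Lemma dist_to_set_ge0 x A : 0 <= dist_to_set x A.
Proof.
have [->|/set0P [y Ay]] := eqVneq A set0.
  by rewrite /dist_to_set image_set0 inf0.
apply: lb_le_inf; first by exists (mdist x y); exists y.
by move=> _ [z _ <-]; exact: mdist_ge0.
Qed.

Lemma dist_to_set_lt x A (e : R) : A !=set0 -> dist_to_set x A < e ->
  exists2 y, A y & mdist x y < e.
Proof.
move=> [z Az] xAe; have hinf : has_inf [set mdist x y | y in A].
  split; first by exists (mdist x z), z.
  by exists 0 => _ [y _ <-]; exact: mdist_ge0.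
move: xAe; rewrite -subr_gt0 => /inf_adherent/(_ hinf)[_ [y Ay <-]].
by rewrite addrC subrK; exists y.
Qed.

Lemma hausdorff_metricC A B : hausdorff_metric A B = hausdorff_metric B A.
Proof. exact: maxC. Qed.

Lemma hausdorff_metric_ge0 A B : 0 <= hausdorff_metric A B.
Proof.
rewrite le_max; apply/orP; left.
(* Where no supremum exists, [sup] takes its default value 0. *)
set S := [set _ | x in A]; have [hs|hs] := pselect (has_sup S); last first.
  by rewrite sup_out.
have [[_ [x Ax _]] hub] := hs.
apply: le_trans (dist_to_set_ge0 x B) _.
by apply: ub_le_sup => //; exists x.
Qed.

Lemma hausdorff_metric_le A B (e : R) : A !=set0 -> B !=set0 ->
  (forall x, A x -> exists2 y, B y & mdist x y <= e) ->
  (forall y, B y -> exists2 x, A x & mdist y x <= e) ->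
  hausdorff_metric A B <= e.
Proof.
move=> [a Aa] [b Bb] AB BA; rewrite ge_max; apply/andP; split.
  apply: ge_sup; first by exists (dist_to_set a B), a.
  move=> _ [x Ax <-]; have [y By xy] := AB x Ax.
  exact: le_trans (dist_to_set_le _ _ _ By) xy.
apply: ge_sup; first by exists (dist_to_set b A), b.
move=> _ [x Ax <-]; have [y By xy] := BA x Ax.
exact: le_trans (dist_to_set_le _ _ _ By) xy.
Qed.

(** Boundedness of [A] makes [sup] a true upper bound, and nonemptiness of [B] lets points of [B]
    approach the infimum. *)
Lemma hausdorff_metric_near A B (e : R) : Pb A -> Pb B ->
  hausdorff_metric A B < e -> forall x, A x -> exists2 y, B y & mdist x y < e.
Proof.
move=> [_ [MA hA]] [[b Bb] _]; rewrite gt_max => /andP[+ _] x Ax.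
move=> supe; apply: dist_to_set_lt; first by exists b.
apply: le_lt_trans supe; apply: ub_le_sup; last by exists x.
exists (MA + mdist x b) => _ [y Ay <-].
apply: le_trans (dist_to_set_le _ _ _ Bb) _.
by rewrite (le_trans (metric_triangle _ x _))// lerD2r hA.
Qed.

(** Used in both directions, this gives uniqueness of limits in [Pbcl]. For large [n] a point of [A]
    is close to [F n], hence to [B], which is closed. *)
Lemma hausdorff_cvg_subset (F : nat -> set X) A B :
  (forall n, Pbcl (F n)) -> Pbcl A -> Pbcl B ->
  hausdorff_metric (F n) A @[n --> \oo] --> (0 : R) ->
  hausdorff_metric (F n) B @[n --> \oo] --> (0 : R) -> A `<=` B.
Proof.
move=> PF PA PB FA FB x Ax.
have PbclW (C : set X) : Pbcl C -> Pb C by case.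
have [_ cB _] := PB; apply: cB; apply/closure_mdistP => e e0.
have e20 : 0 < e / 2 by rewrite divr_gt0.
have small (C : set X) : hausdorff_metric (F n) C @[n --> \oo] --> (0 : R) ->
    \forall n \near \oo, hausdorff_metric (F n) C < e / 2.
  move=> FC; near=> n; rewrite -(ger0_norm (hausdorff_metric_ge0 _ _)).
  by near: n; move/cvgr0Pnorm_lt : FC; exact.
have [n [nA nB]] : exists n, hausdorff_metric (F n) A < e / 2 /\
    hausdorff_metric (F n) B < e / 2.
  have [n _ hn] := filterI (small _ FA) (small _ FB).
  by exists n; apply: hn => /=.
rewrite hausdorff_metricC in nA.
have PFn := PbclW _ (PF n).
have [y Fy xy] := hausdorff_metric_near A (F n) _ (PbclW _ PA) PFn nA _ Ax.
have [z Bz yz] := hausdorff_metric_near (F n) B _ PFn (PbclW _ PB) nB _ Fy.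
by exists z => //; have := metric_triangle x y z; lra.
Unshelve. all: by end_near. Qed.

Lemma lip_on_le A (g : X -> X) (c : R) : 0 <= c -> (lip_on A g <= c%:E)%E ->
  forall x y, A x -> A y -> mdist (g x) (g y) <= c * mdist x y.
Proof.
move=> c0 gc x y Ax Ay; have [->|xy] := eqVneq x y.
  by rewrite !mdistxx mulr0.
rewrite -ler_pdivrMr ?mdist_gt0// -lee_fin; apply: le_trans gc.
by apply: ereal_sup_ubound; exists (x, y).
Qed.

End MetricFacts.

(** As [r n] controls the whole tail after [n], it suffices that [r] gets small at single indices;
    the same bound passes to the limit. *)
Lemma fast_cauchy_cvg {R : realType} {X : completeMetricType R}
    (u : nat -> X) (r : nat -> R) :
  (forall n m, (n <= m)%N -> mdist (u n) (u m) <= r n) ->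
  (forall e, 0 < e -> exists n, r n <= e) ->
  (forall n, mdist (u n) (lim (u @ \oo)) <= r n) /\ u @ \oo --> lim (u @ \oo).
Proof.
move=> ur r0; have cu : cvg (u @ \oo).
  apply: cauchy_cvg; apply: cauchy_exP => e e0.
  have [n rn] := r0 (e / 2) ltac:(by rewrite divr_gt0).
  exists (u n), n => // m /= nm; rewrite ballEmdist /=.
  by have := ur _ _ nm; lra.
split=> // n; apply/ler_addgt0Pr => e e0.
have /cvgrPdist_lt/(_ e e0) [m _ hm] := cu.
have := hm (maxn n m) (leq_maxr _ _); have := ur n (maxn n m) (leq_maxl _ _).
rewrite (metric_sym (lim _)) => /= h1 h2.
by have := metric_triangle (u n) (u (maxn n m)) (lim (u @ \oo)); lra.
Qed.

Lemma geometric_small {R : realType} (a K e : R) : 0 <= a < 1 -> 0 < e ->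
  exists n, a ^+ n * K <= e.
Proof.
move=> /andP[a0 a1] e0; have : (a ^+ n * K) @[n --> \oo] --> (0 : R).
  rewrite -[X in _ --> X](mul0r K); apply: cvgMr_tmp.
  by apply: cvg_expr; rewrite ger0_norm.
move/cvgr0Pnorm_lt => /(_ e e0) [n _ /(_ n (leqnn _)) /= hn].
by exists n; apply: ltW; exact: le_lt_trans (ler_norm _) hn.
Qed.

(** * Combinatorics of words: blocks of letters from [J], prefixes, prolongations *)

Section Words.
Context {I J : Type}.
Implicit Types (w z : seq (I + J)) (v : seq J).

Lemma J_prefix w : exists v z, w = map inr v ++ z /\ (z = [::] \/ starts_in_I z).
Proof.
elim: w => [|[i|j] w [v [z [-> hz]]]]; first by exists [::], [::]; split=> //; left.
  by exists [::], (inl i :: map inr v ++ z); split=> //; right.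
by exists (j :: v), z.
Qed.

Lemma starts_in_IP z : starts_in_I z -> exists i z', z = inl i :: z'.
Proof. by case: z => [//|[i|//] z] _; exists i, z. Qed.

Lemma ends_in_I_cat w z : ends_in_I z -> ends_in_I (w ++ z).
Proof. by rewrite /ends_in_I rev_cat; case: (rev z). Qed.

(** At most [p] letters from [I] leave at most [p + 1] blocks of letters from [J], which cannot all
    be shorter than [q]. The block found is maximal, as [Sigma0] demands around an infinite
    letter. *)
Lemma long_J_block q p w : (count letter_in_I w <= p)%N ->
  (p.+1 * q.+1 <= size w)%N ->
  exists u v z, [/\ w = u ++ map inr v ++ z, (q <= size v)%N,
    u = [::] \/ ends_in_I u & z = [::] \/ starts_in_I z].
Proof.
elim: p w => [|p IH] w.
  have [v [z [-> [->|/starts_in_IP[i [z' ->]]]]]] := J_prefix w.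
    rewrite cats0 size_map => _ hs; exists [::], v, [::].
    by rewrite cats0; split=> //; [lia|left|left].
  by rewrite count_cat /=; lia.
have [v [z [-> hz]]] := J_prefix w.
have [qv|vq] := leqP q (size v).
  by move=> _ _; exists [::], v, z; split=> //; left.
case: hz => [->|/starts_in_IP[i [z' ->]]].
  by rewrite cats0 size_map; nia.
rewrite count_cat size_cat size_map /= => hc hs.
have [||u [v' [z'' [-> qv' hu hz]]]] := IH z'; [by lia|by nia|].
exists (map inr v ++ inl i :: u), v', z''; split=> //.
  by rewrite -catA.
right; apply: ends_in_I_cat; case: hu => [->//|hu].
by rewrite -cat1s ends_in_I_cat.
Qed.

Lemma Sigma1_count (alpha : infword (I + J)) p : Sigma1 I J alpha ->
  exists n, (p <= count letter_in_I (infword_prefix alpha n))%N.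
Proof.
move=> alphaI; elim: p => [|p [n hn]]; first by exists 0%N.
have [m [nm am]] : exists m, (n <= m)%N /\ letter_in_I (alpha m).
  (* Otherwise all positions of letters from [I] would lie below [n]. *)
  apply: contrapT => hno; apply: alphaI.
  apply: (@sub_finite_set _ _ `I_n); last exact: finite_II.
  move=> m /= am; rewrite ltnNge; apply/negP => nm; apply: hno.
  by exists m.
exists m.+1; rewrite /infword_prefix mkseqS -cats1 count_cat /= am.
rewrite addn0 addn1 ltnS (leq_trans hn)//.
rewrite -(subnKC nm) /infword_prefix /mkseq iotaD map_cat count_cat.
exact: leq_addr.
Qed.

Lemma infword_prefixD (K : Type) (alpha : infword K) n m : (n <= m)%N ->
  exists u, infword_prefix alpha m = infword_prefix alpha n ++ u.
Proof.
move=> nm; rewrite -(subnKC nm) /infword_prefix /mkseq iotaD map_cat.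
by eexists.
Qed.

(** Beyond the end of [u], [nth] returns its default [k]: the word [u] is followed by [k]
    forever. *)
Definition word_extend {K : Type} (u : seq K) (k : K) : infword K := nth k u.

Lemma word_extend_prefix {K : Type} (u : seq K) (k : K) :
  infword_prefix (word_extend u k) (size u) = u.
Proof. exact: mkseq_nth. Qed.

Lemma Sigma1_extend w i : Sigma1 I J (word_extend w (inl i)).
Proof.
move=> /finite_seqP[s hs].
(* This position lies past [w], where every letter is [inl i], and past all positions listed in
   [s]. *)
have : [set n | letter_in_I (word_extend w (inl i) n)]
    (size w + \max_(k <- s) k).+1.
  by apply/eqP; rewrite /word_extend nth_default // leqW // leq_addr.
rewrite hs /= => hin; have := @leq_bigmax_seq _ _ predT id _ hin isT.
by rewrite leqNgt ltnS leq_addl.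
Qed.

End Words.

(** * Estimates for word maps and for their limits *)

Section Contractions.
Context {R : realType} {X : completeMetricType R} {I J : Type}.
Context {f : I + J -> X -> X} {a : R} (a01 : 0 <= a < 1).
Context (f1 : forall k x y, mdist (f k x) (f k y) <= mdist x y).
Context (fI : forall i x y, mdist (f (inl i) x) (f (inl i) y) <= a * mdist x y).
Context (fJ : forall x j y z, Jorbit f x y -> Jorbit f x z ->
  mdist (f (inr j) y) (f (inr j) z) <= a * mdist y z).
Implicit Types (w s t : seq (I + J)) (v : seq J) (B : set X).

Local Notation "''f_' w" := (word_map f w)
  (at level 8, w at level 2, format "''f_' w").
Local Notation inrs := (map (@inr I J)).

Let a0 : 0 <= a. Proof. by case/andP: a01. Qed.
Let a1 : a < 1. Proof. by case/andP: a01. Qed.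

Lemma word_map_cat s t x : 'f_(s ++ t) x = 'f_s ('f_t x).
Proof. by elim: s => //= k s ->. Qed.

Lemma word_map_le w x y : mdist ('f_w x) ('f_w y) <= mdist x y.
Proof. by elim: w => //= k w; exact/le_trans/f1. Qed.

Lemma word_map_contract w x y :
  mdist ('f_w x) ('f_w y) <= a ^+ count letter_in_I w * mdist x y.
Proof.
elim: w => [|[i|j] w IH] /=; first by rewrite expr0 mul1r.
- by rewrite add1n exprS -mulrA (le_trans (fI _ _ _))// ler_wpM2l.
- by rewrite add0n (le_trans (f1 _ _ _)).
Qed.

Lemma Jorbit_word v x : Jorbit f x ('f_(inrs v) x).
Proof. by exists (size v) => //; apply: subset_closure; exists v. Qed.

(** Both points stay in the [J]-orbit of the common base point [x], so every letter of [v]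
    contributes a factor [a]. *)
Lemma J_word_contract v v1 v2 x :
  mdist ('f_(inrs (v ++ v1)) x) ('f_(inrs (v ++ v2)) x) <=
  a ^+ size v * mdist ('f_(inrs v1) x) ('f_(inrs v2) x).
Proof.
elim: v => [|j v IH]; first by rewrite expr0 mul1r.
rewrite /= exprS -mulrA (le_trans (fJ x _ _ _ _ _))//; try exact: Jorbit_word.
exact: ler_wpM2l.
Qed.

Lemma displacement_bounded B : (forall B, Pb B -> Pb (\bigcup_k (f k @` B))) ->
  Pb B -> exists2 D, 0 <= D & forall k x, B x -> mdist (f k x) x <= D.
Proof.
move=> hB PB; have [[x0 Bx0] [M BM]] := PB.
have [[_ [k0 _ _]] [M' FM']] := hB B PB.
(* The path from [f k x] to [x] goes through [f k0 x0] and [x0]; its first step stays in the bounded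
   union of images. *)
exists (M' + mdist (f k0 x0) x0 + M).
  rewrite !addr_ge0 ?mdist_ge0//.
    apply: le_trans (FM' (f k0 x0) (f k0 x0) _ _); first exact: mdist_ge0.
      by exists k0 => //; exists x0.
    by exists k0 => //; exists x0.
  by apply: le_trans (BM _ _ Bx0 Bx0); exact: mdist_ge0.
move=> k x Bx; rewrite (le_trans (metric_triangle3 _ (f k0 x0) x0 _))//.
rewrite !lerD ?BM//; apply: FM'; first by exists k => //; exists x.
by exists k0 => //; exists x0.
Qed.

Lemma words_bounded B : (forall B, Pb B -> Pb (\bigcup_k (f k @` B))) ->
  Pb B -> exists K, forall x y s t, B x -> B y -> mdist ('f_s x) ('f_t y) <= K.
Proof.
move=> hB PB; have [D D0 BD] := displacement_bounded B hB PB.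
have [_ [L BL]] := PB.
have a1' : 0 < 1 - a by rewrite subr_gt0.
(* [E] and [M] are the fixed points of [t -> a t + D] and [t -> a t + (E + D)]; they bound the
   displacement under words over [J] and under all words. *)
pose E := D / (1 - a); pose M := (E + D) / (1 - a).
have E0 : 0 <= E by rewrite divr_ge0// ltW.
have aE : a * E + D = E by rewrite /E; field; rewrite gt_eqF.
have aM : a * M + (E + D) = M by rewrite /M; field; rewrite gt_eqF.
have M0 : 0 <= M by rewrite divr_ge0 ?[0 <= E + D]addr_ge0// ltW.
have EM : E <= M by have := mulr_ge0 a0 M0; lra.
have hJ v x : B x -> mdist ('f_(inrs v) x) x <= E.
  move=> Bx; elim: v => [|j v IH] /=; first by rewrite mdistxx.
  rewrite (le_trans (metric_triangle _ (f (inr j) x) _))// -[leRHS]aE lerD ?BD//.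
  apply: le_trans (fJ x _ _ _ (Jorbit_word v x) (Jorbit_word [::] x)) _.
  exact: ler_wpM2l.
(* The accumulator [v] collects letters from [J] until one from [I] comes, so that a whole block
   costs [E] only once. *)
have hw w v x : B x -> mdist ('f_(inrs v ++ w) x) x <= M.
  move=> Bx; elim: w v => [|[i|j] w IH] v.
    by rewrite cats0 (le_trans (hJ _ _ Bx)).
    rewrite word_map_cat /=.
    have h1 := word_map_le (inrs v) (f (inl i) ('f_w x)) x.
    have h2 := fI i ('f_w x) x; have h3 := BD (inl i) x Bx.
    have h4 := ler_wpM2l a0 (IH [::]); have h5 := hJ v x Bx.
    have h6 := metric_triangle ('f_(inrs v) (f (inl i) ('f_w x))) ('f_(inrs v) x) x.
    have h7 := metric_triangle (f (inl i) ('f_w x)) (f (inl i) x) x.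
    move: h4 => /=; lra.
  by have := IH (rcons v j); rewrite map_rcons cat_rcons.
exists (M + L + M) => x y s t Bx By.
rewrite (le_trans (metric_triangle3 _ x y _))// !lerD ?BL//.
  exact: (hw s [::]).
by rewrite metric_sym; exact: (hw t [::]).
Qed.

(* Induction on [p]: a long initial block of letters from [J] may be cut down to
   its first [q] letters, or lengthened at will, at the cost [a ^+ q * K]; the
   first letter from [I] contracts the error made on the rest of the word. *)
Lemma word_resize x K q : (I + J) -> (forall s t, mdist ('f_s x) ('f_t x) <= K) ->
  forall p w n, (p * q.+1 <= size w)%N -> (p * q.+1 <= n)%N ->
  exists2 w', size w' = n & mdist ('f_w x) ('f_w' x) <= (p%:R * a ^+ q + a ^+ p) * K.
Proof.
move=> k0 xK; have K0 : 0 <= K by exact: le_trans (mdist_ge0 _ _) (xK [::] [::]).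
have aq0 : 0 <= a ^+ q * K by rewrite mulr_ge0// exprn_ge0.
elim=> [|p IH] w n hw hn.
  (* For [p = 0] the bound is [K], so any word of length [n] serves. *)
  exists (nseq n k0); first exact: size_nseq.
  by rewrite mul0r add0r expr0 mul1r.
have apq0 : 0 <= p%:R * a ^+ q * K + a ^+ p.+1 * K.
  by rewrite addr_ge0// mulr_ge0// ?mulr_ge0// exprn_ge0.
have [v [z [ew hz]]] := J_prefix w; subst w.
(* Within a block of letters from [J], whatever follows the first [q] letters matters only up to
   [a ^+ q * K]. *)
have J_change v1 v2 v' t : (q <= size v')%N -> v = v' ++ v1 ->
    mdist ('f_(inrs v ++ t) x) ('f_(inrs (v' ++ v2) ++ t) x) <= a ^+ q * K.
  move=> qv' ->; rewrite !word_map_cat.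
  apply: le_trans (J_word_contract _ _ _ _) _.
  by rewrite ler_pM ?exprn_ge0 ?mdist_ge0// -?word_map_cat// ler_wiXn2l// ltW.
have J_lengthen z' : (q < size v)%N -> (q + size z' <= n)%N ->
    exists2 w', size w' = n & mdist ('f_(inrs v ++ z') x) ('f_w' x) <= a ^+ q * K.
  move=> qv hn'.
  have [j _] : exists j : J, True by case: (v) qv => // j; exists j.
  exists (inrs (take q v ++ nseq (n - q - size z') j) ++ z').
    rewrite size_cat size_map size_cat size_nseq size_takel; lia.
  apply: (J_change (drop q v)); last by rewrite cat_take_drop.
  by rewrite size_takel// ltnW.
have goalW c : c <= a ^+ q * K -> c <= (p.+1%:R * a ^+ q + a ^+ p.+1) * K.
  move=> hc; rewrite mulrDl -natr1 !mulrDl mul1r; lra.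
case: hz => [z0|/starts_in_IP[i [z' ez]]]; subst z.
  have [||w' <- hw'] := J_lengthen [::].
  - by move: hw; rewrite cats0 size_map; nia.
  - by rewrite addn0; nia.
  - by exists w' => //; exact: goalW.
move: hw; rewrite size_cat size_map /= => hw.
(* If [z'] is too short for the induction hypothesis, then [v] has more than [q] letters and can be
   adjusted alone. *)
have [hz'|hz'] := leqP (p * q.+1) (size z'); last first.
  have [||w' <- hw'] := J_lengthen (inl i :: z'); [by nia|by rewrite /=; nia|].
  by exists w' => //; exact: goalW.
(* Keeping at most [q] letters of [v] leaves a target length of at least [p * q.+1] for the rest. *)
have sz : (size (take q v) <= q)%N by rewrite size_take; case: ltnP; lia.
have [|z'' sz'' hz''] := IH z' (n - size (take q v) - 1)%N hz'; first by nia.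
exists (inrs (take q v) ++ inl i :: z'').
  by rewrite size_cat /= size_map sz''; nia.
have h1 : mdist ('f_(inrs v ++ inl i :: z') x)
    ('f_(inrs (take q v) ++ inl i :: z') x) <= a ^+ q * K.
  have [vq|qv] := leqP (size v) q; first by rewrite take_oversize// mdistxx.
  rewrite -[in X in mdist _ X](cats0 (take q v)).
  apply: (J_change (drop q v)); last by rewrite cat_take_drop.
  by rewrite size_takel// ltnW.
have h2 := word_map_le (inrs (take q v)) ('f_(inl i :: z') x) ('f_(inl i :: z'') x).
have h3 := fI i ('f_z' x) ('f_z'' x).
have h4 := ler_wpM2l a0 hz''.
have h5 : a * (p%:R * a ^+ q * K) <= p%:R * a ^+ q * K.
  by rewrite ler_piMl ?mulr_ge0// ?exprn_ge0// ltW.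
rewrite (le_trans (metric_triangle _ ('f_(inrs (take q v) ++ inl i :: z') x) _))//.
move: h1 h2 h3; rewrite !word_map_cat /= => h1 h2 h3.
move: h4; rewrite -[p.+1%:R]natr1 exprS !mulrDl mul1r mulrDr mulrA; lra.
Qed.

Lemma a_map_J (gamma : infword J) x K n :
  (forall s t, mdist ('f_s x) ('f_t x) <= K) ->
  mdist ('f_(infword_prefix (inr \o gamma) n) x) (a_map f (inr \o gamma) x)
    <= a ^+ n * K.
Proof.
move=> xK.
have E m : infword_prefix (inr \o gamma) m = inrs (infword_prefix gamma m).
  by rewrite /infword_prefix /mkseq map_comp.
have [||h _] := @fast_cauchy_cvg _ _
  (fun m => 'f_(infword_prefix (inr \o gamma) m) x) (fun m => a ^+ m * K).
- move=> m l ml; rewrite !E; have [w ->] := infword_prefixD _ gamma _ _ ml.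
  rewrite -[in X in mdist X _](cats0 (infword_prefix gamma m)).
  apply: le_trans (J_word_contract _ _ _ _) _.
  by rewrite size_mkseq ler_wpM2l// exprn_ge0.
- by move=> e e0; exact: geometric_small.
- exact: h.
Qed.

(** Only letters from [I] are counted as contracting; infinitely many of them drive the bound to
    0. *)
Lemma a_map_Sigma1 (alpha : infword (I + J)) x K n : Sigma1 I J alpha ->
  (forall s t, mdist ('f_s x) ('f_t x) <= K) ->
  mdist ('f_(infword_prefix alpha n) x) (a_map f alpha x)
    <= a ^+ count letter_in_I (infword_prefix alpha n) * K.
Proof.
move=> alphaI xK.
have K0 : 0 <= K by exact: le_trans (mdist_ge0 _ _) (xK [::] [::]).
have [||h _] := @fast_cauchy_cvg _ _ (fun m => 'f_(infword_prefix alpha m) x)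
  (fun m => a ^+ count letter_in_I (infword_prefix alpha m) * K).
- move=> m l ml; have [w ->] := infword_prefixD _ alpha _ _ ml.
  rewrite word_map_cat (le_trans (word_map_contract _ _ _))//.
  by rewrite ler_wpM2l ?exprn_ge0//; exact: (xK [::]).
- move=> e e0; have [p hp] := geometric_small a K e a01 e0.
  have [m pm] := Sigma1_count _ p alphaI; exists m; apply: le_trans hp.
  by rewrite ler_wpM2r// ler_wiXn2l// ltW.
- exact: h.
Qed.

(** Each infinite letter is replaced by a long prefix of itself; the outer word maps are
    nonexpansive and do not enlarge the error. *)
Lemma calA_near_word (alpha : block_word I J + infword (I + J)) x N (e : R) :
  (forall B, Pb B -> Pb (\bigcup_k (f k @` B))) -> Sigma I J alpha -> 0 < e ->
  exists2 w, (N <= size w)%N & mdist ('f_w x) (calA f alpha x) <= e.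
Proof.
move=> hB.
(* The inner limits are evaluated at points that need not lie in a given bounded set, so each point
   gets its own bound, from its singleton. *)
have orbit_bounded y : exists K, forall s t, mdist ('f_s y) ('f_t y) <= K.
  have [|K hK] := words_bounded [set y] hB; last first.
    by exists K => s t; exact: hK.
  split; first by exists y.
  by exists 0 => _ _ -> ->; rewrite mdistxx.
case=> [[[u bs] [bs0 _ _ _] <-]|[al alI <-]] e0; last first.
  have [K hK] := orbit_bounded x; have [p hp] := geometric_small a K e a01 e0.
  have K0 : 0 <= K by exact: le_trans (mdist_ge0 _ _) (hK [::] [::]).
  have [m pm] := Sigma1_count _ p alI.
  exists (infword_prefix al (maxn N m)); first by rewrite size_mkseq leq_maxl.
  apply: le_trans (a_map_Sigma1 _ _ _ _ alI hK) _.
  apply: le_trans hp; rewrite ler_wpM2r// ler_wiXn2l//; first exact: ltW.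
  have [t ->] := infword_prefixD _ al _ _ (leq_maxr N m).
  by rewrite count_cat (leq_trans pm)// leq_addr.
have {bs0} : bs <> [::] by case: bs bs0.
(* The error is generalized so that each block can spend half of it; the length condition is void
   for the empty list, which yields the empty word. *)
suff blocks e' : 0 < e' -> exists2 w, bs <> [::] -> (N <= size w)%N &
    mdist ('f_w x) (foldr (fun p g => a_map f (inr \o p.1) \o 'f_p.2 \o g) id bs x)
      <= e'.
  have [w Nw hw] := blocks e e0; move=> /Nw {}Nw.
  exists (u ++ w); first by rewrite size_cat (leq_trans Nw)// leq_addl.
  by rewrite word_map_cat; exact: le_trans (word_map_le _ _ _) hw.
move=> {e e0}; elim: bs e' => [|[gamma b] bs IH] e e0.
  by exists [::] => //=; rewrite mdistxx ltW.
have e20 : 0 < e / 2 by rewrite divr_gt0.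
rewrite /=; set y := foldr _ _ _ _ in IH *; have [w _ hw] := IH _ e20.
have [K hK] := orbit_bounded ('f_b y); have [p hp] := geometric_small a K _ a01 e20.
have K0 : 0 <= K by exact: le_trans (mdist_ge0 _ _) (hK [::] [::]).
exists (infword_prefix (inr \o gamma) (maxn N p) ++ b ++ w).
  by move=> _; rewrite size_cat size_mkseq (leq_trans (leq_maxl N p))// leq_addr.
rewrite !word_map_cat.
rewrite (le_trans (metric_triangle _
  ('f_(infword_prefix (inr \o gamma) (maxn N p)) ('f_b y)) _))//.
rewrite [leRHS]splitr lerD//.
  by rewrite (le_trans (word_map_le _ _ _))// (le_trans (word_map_le _ _ _)).
apply: le_trans (a_map_J _ _ _ _ hK) _; apply: le_trans hp.
by rewrite ler_wpM2r// ler_wiXn2l ?leq_maxr// ltW.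
Qed.

Lemma word_near_length K (e : R) : (I + J) -> 0 < e -> exists N, forall x w n,
  (forall s t, mdist ('f_s x) ('f_t x) <= K) -> (N <= size w)%N -> (N <= n)%N ->
  exists2 w', size w' = n & mdist ('f_w x) ('f_w' x) <= e.
Proof.
move=> k0 e0; have e20 : 0 < e / 2 by rewrite divr_gt0.
(* [p] comes first, since [q] must make [a ^+ q] small against the factor [p]. *)
have [p hp] := geometric_small a K _ a01 e20.
have [q hq] := geometric_small a (p%:R * K) _ a01 e20.
exists (p * q.+1)%N => x w n hK hw hn.
have [w' sw' hw'] := word_resize x K q k0 hK p w n hw hn.
exists w' => //; apply: le_trans hw' _.
by rewrite mulrDl mulrAC mulrC [leRHS]splitr lerD.
Qed.

Lemma word_near_calA K (e : R) : 0 < e -> exists N, forall x w,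
  (forall s t, mdist ('f_s x) ('f_t x) <= K) -> (N <= size w)%N ->
  exists2 alpha, Sigma I J alpha & mdist ('f_w x) (calA f alpha x) <= e.
Proof.
move=> e0; have [p hp] := geometric_small a K e a01 e0.
(* This is the threshold of [long_J_block] for blocks of length [p.+1]. *)
exists (p.+1 * p.+2)%N => x w hK hw.
have K0 : 0 <= K by exact: le_trans (mdist_ge0 _ _) (hK [::] [::]).
have small n : (p <= n)%N -> a ^+ n * K <= e.
  by move=> pn; apply: le_trans hp; rewrite ler_wpM2r// ler_wiXn2l// ltW.
have [wp|pw] := leqP (count letter_in_I w) p.
  have [u [v [z [-> pv hu hz]]]] := long_J_block _ _ _ wp hw.
  have [j _] : exists j : J, True by case: (v) pv => // j; exists j.
  exists (inl (BlockWord u [:: (word_extend v j, z)])).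
    left; eexists; last by []; split=> //=.
    by move=> [|k]; rewrite // ltnS.
  have -> : inrs v = infword_prefix (inr \o word_extend v j) (size v).
    by rewrite -[in LHS](word_extend_prefix v j) /infword_prefix /mkseq map_comp.
  rewrite !word_map_cat /= (le_trans (word_map_le _ _ _))//.
  apply: le_trans (a_map_J _ _ K _ _) _; last exact/small/ltnW.
  by move=> s t; rewrite -!word_map_cat.
have [i _] : exists i : I, True.
  by elim: (w) pw => [//|[i|j] w' IH]; [exists i|exact: IH].
exists (inr (word_extend w (inl i))).
  by right; eexists; last by []; exact: Sigma1_extend.
have := a_map_Sigma1 _ _ _ (size w) (Sigma1_extend w i) hK.
by rewrite word_extend_prefix => /le_trans; apply; exact/small/ltnW.
Qed.

Definition word_images B n : set X :=
  [set y | exists w x, [/\ size w = n, B x & y = 'f_w x]].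

(** Nonexpansive maps send a closure into the closure of the image, so inner closures are absorbed;
    closedness of [B] settles [n = 0]. *)
Lemma iter_fractal_operator B n : closed B ->
  iter n (fractal_operator f) B = closure (word_images B n).
Proof.
move=> cB; elim: n => [|n /= ->].
  apply/seteqP; split=> [x Bx|].
    by apply: subset_closure; exists [::], x.
  apply: subset_trans (_ : closure B `<=` _); last exact: cB.
  apply: closureS => _ [w [x [/size0nil -> Bx ->]]] //.
apply/seteqP; split.
  rewrite [X in _ `<=` X](closure_id _).1; last exact: closed_closure.
  apply: closureS.
  move=> _ [k _ [y /closure_mdistP hy <-]]; apply/closure_mdistP => e e0.
  have [_ [w [x [<- Bx ->]]] yw] := hy e e0.
  by exists ('f_(k :: w) x); [exists (k :: w), x|exact: le_lt_trans (f1 _ _ _) yw].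
apply: closureS => _ [[|k w] [x [//= [sw] Bx ->]]].
by exists k => //; exists ('f_w x) => //; apply: subset_closure; exists w, x.
Qed.

End Contractions.

Theorem theorem3p12 (R : realType) (X : completeMetricType R) (I J : Type)
  (f : I + J -> X -> X) (hf : mIIFS f) (B : set X) (hB : Pbcl B) :
  closure [set y | exists alpha x, [/\ Sigma I J alpha, B x & y = calA f alpha x]]
  = fractal_limit f B.
Proof.
have [_ fb lip1 [a a01 [lipI lipJ]]] := hf.
have a0 : 0 <= a by case/andP: a01.
have f1 k x y : mdist (f k x) (f k y) <= mdist x y.
  by have := lip_on_le _ _ _ ler01 (lip1 k) x y Logic.I Logic.I; rewrite mul1r.
have fI i x y : mdist (f (inl i) x) (f (inl i) y) <= a * mdist x y.
  exact: lip_on_le a0 (lipI i) _ _ _ _.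
have fJ x j y z : Jorbit f x y -> Jorbit f x z ->
    mdist (f (inr j) y) (f (inr j) z) <= a * mdist y z.
  move=> xy xz; apply: lip_on_le a0 (lipJ x j) _ _ _ _; exact: subset_closure.
have [[x0 Bx0] cB bB] := hB; have PB : Pb B by split=> //; exists x0.
(* The union of the images of [B] is nonempty, so there is a letter [k0]. *)
have [_ [k0 _ _]] := (fb B PB).1.
have [K hK] := words_bounded a01 f1 fI fJ B fb PB.
have hKx x : B x -> forall s t, mdist (word_map f s x) (word_map f t x) <= K.
  by move=> Bx s t; exact: hK.
set Y := [set y | _].
have PY : Pb Y.
  split.
    have [N hN] := word_near_calA a01 f1 fI fJ K 1 ltr01.
    have [|al Sal _] := hN x0 (nseq N k0) (hKx _ Bx0); first by rewrite size_nseq.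
    by exists (calA f al x0), al, x0.
  exists K => _ _ [al [x [Sal Bx ->]]] [be [y [Sbe By ->]]].
  apply/ler_addgt0Pr => e e0; have e20 : 0 < e / 2 by rewrite divr_gt0.
  have [s _ hs] := calA_near_word a01 f1 fI fJ al x 0 (e / 2) fb Sal e20.
  have [t _ ht] := calA_near_word a01 f1 fI fJ be y 0 (e / 2) fb Sbe e20.
  have := metric_triangle3 (calA f al x) (word_map f s x) (word_map f t y)
    (calA f be y).
  rewrite (metric_sym (calA f al x) (word_map f s x)).
  by have := hK x y s t Bx By; lra.
have W0 n : word_images (f := f) B n !=set0.
  by exists (word_map f (nseq n k0) x0), (nseq n k0), x0; rewrite size_nseq.
have PW n : Pb (word_images (f := f) B n).
  split; first exact: W0.
  by exists K => _ _ [s [x [_ Bx ->]]] [t [y [_ By ->]]]; exact: hK.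
have limY : hausdorff_metric (iter n (fractal_operator f) B) (closure Y)
    @[n --> \oo] --> (0 : R).
  apply/cvgr0Pnorm_le => e e0; have e30 : 0 < e / 3 by rewrite divr_gt0.
  have [N1 hN1] := word_near_calA a01 f1 fI fJ K (e / 3) e30.
  have [N2 hN2] := word_near_length a01 f1 fI fJ K (e / 3) k0 e30.
  exists (maxn N1 N2) => // n /=; rewrite geq_max => /andP[N1n N2n].
  rewrite (ger0_norm (hausdorff_metric_ge0 _ _)) (iter_fractal_operator f1)//.
  have [F0 _ _] := Pbcl_closure _ (PW n).
  have [clY0 _ _] := Pbcl_closure _ PY.
  apply: hausdorff_metric_le => // z /closure_mdistP/(_ _ e30).
    move=> [_ [w [x [sw Bx ->]]] zw].
    have [|al Sal hal] := hN1 x w (hKx _ Bx); first by rewrite sw.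
    exists (calA f al x); first by apply: subset_closure; exists al, x.
    by have := metric_triangle z (word_map f w x) (calA f al x); lra.
  (* The three thirds of [e] pay for leaving the closure, for passing to a long word, and for giving
     it length exactly [n]. *)
  move=> [_ [al [x [Sal Bx ->]]] zal].
  have [w Nw hw] := calA_near_word a01 f1 fI fJ al x N2 _ fb Sal e30.
  have [w' sw' hw'] := hN2 x w n (hKx _ Bx) Nw N2n.
  exists (word_map f w' x); first by apply: subset_closure; exists w', x.
  have := metric_triangle3 z (calA f al x) (word_map f w x) (word_map f w' x).
  by rewrite (metric_sym (calA f al x) (word_map f w x)); lra.
have PYcl := Pbcl_closure _ PY.
(* As [closure Y] is one such limit, [get] returns a limit and not its default value. *)
have [PA limA] : [set A | Pbcl A /\
    hausdorff_metric (iter n (fractal_operator f) B) A @[n --> \oo]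
      --> (0 : R)] (fractal_limit f B).
  by apply: getPex; exists (closure Y).
have PF n : Pbcl (iter n (fractal_operator f) B).
  by rewrite iter_fractal_operator//; exact: Pbcl_closure.
by apply/seteqP; split; apply: hausdorff_cvg_subset PF _ _ _ _.
Qed.
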